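(* Let $n$ be a positive integer with $n\equiv 0\pmod 6$, and let $H$ be a finite abelian group of order $n^2+n+1$ with identity $e$. Then there are no inverse-closed subsets $T_0,T_1\subseteq H$ with $e\in T_0$ and $|T_0|+|T_1|=2n+1$ satisfying in $\mathbb{Z}[H]$ $$T_0T_1=H-e\quad\text{and}\quad T_0^2+T_1^2=2H-T_0^{(2)}-T_1^{(2)}+2n\,e.$$
   Context: $\mathbb{Z}[H]$ is the group ring of $H$ over $\mathbb{Z}$; a subset $D\subseteq H$ is identified with $\sum_{d\in D}d$, and $H$ also denotes $\sum_{h\in H}h$. For $A=\sum a_h h$ and $t\in\mathbb{Z}$, $A^{(t)}=\sum a_h h^t$. A subset $D$ is inverse-closed if $D^{(-1)}=D$. *)

(* Defs.v *)
From HB Require Import structures.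
From mathcomp Require Import all_boot all_order all_algebra all_fingroup.

Set Implicit Arguments.
Unset Strict Implicit.
Unset Printing Implicit Defensive.

Import GRing.Theory.
Local Open Scope ring_scope.

Section GroupRing.

Variable gT : finGroupType.

(* Z[gT]: A : zgroup_ring stands for \sum_h (A h) h.  The alias carries the
   convolution product, as {ffun gT -> int} itself has the pointwise one. *)
Definition zgroup_ring := {ffun gT -> int}.

HB.instance Definition _ := GRing.Zmodule.copy zgroup_ring {ffun gT -> int}.

Definition zgr_elt (g : gT) : zgroup_ring := [ffun h => (h == g)%:R].

Definition zgr_mul (A B : zgroup_ring) : zgroup_ring :=
  [ffun h => \sum_(k : gT) A k * B (k^-1 * h)%g].

Fact zgr_mulA : associative zgr_mul.
Proof.
move=> A B C; apply/ffunP=> h; rewrite !ffunE.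
under eq_bigr => k _ do rewrite ffunE mulr_sumr.
under [RHS]eq_bigr => k _ do rewrite ffunE mulr_suml.
rewrite [RHS]exchange_big /=; apply: eq_bigr => k _.
rewrite [RHS](reindex_inj (mulgI k)) /=; apply: eq_bigr => l _.
by rewrite mulrA mulKg invMg mulgA.
Qed.

Fact zgr_mul1l : left_id (zgr_elt 1%g) zgr_mul.
Proof.
move=> A; apply/ffunP=> h; rewrite ffunE (bigD1 1%g) //= big1 => [|k k1].
  by rewrite ffunE eqxx mul1r invg1 mul1g addr0.
by rewrite ffunE (negPf k1) mul0r.
Qed.

Fact zgr_mul1r : right_id (zgr_elt 1%g) zgr_mul.
Proof.
move=> A; apply/ffunP=> h; rewrite ffunE (bigD1 h) //= big1 => [|k kh].
  by rewrite ffunE mulVg eqxx mulr1 addr0.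
by rewrite ffunE -eq_mulVg1 (negPf kh) mulr0.
Qed.

Fact zgr_mulDl : left_distributive zgr_mul +%R.
Proof.
move=> A B C; apply/ffunP=> h; rewrite !ffunE -big_split /=.
by apply: eq_bigr => k _; rewrite ffunE mulrDl.
Qed.

Fact zgr_mulDr : right_distributive zgr_mul +%R.
Proof.
move=> A B C; apply/ffunP=> h; rewrite !ffunE -big_split /=.
by apply: eq_bigr => k _; rewrite ffunE mulrDr.
Qed.

Fact zgr_one_neq0 : zgr_elt 1%g != 0.
Proof. by apply/eqP => /ffunP/(_ 1%g); rewrite !ffunE eqxx. Qed.

HB.instance Definition _ := GRing.Zmodule_isNzRing.Build zgroup_ring
  zgr_mulA zgr_mul1l zgr_mul1r zgr_mulDl zgr_mulDr zgr_one_neq0.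

Definition zgr_set (D : {set gT}) : zgroup_ring := \sum_(d in D) zgr_elt d.

Definition expgz (g : gT) (t : int) : gT :=
  match t with
  | Posz m => (g ^+ m)%g
  | Negz m => (g ^- m.+1)%g
  end.

(* A^(t) := \sum_h a_h h^t *)
Definition zgr_power (t : int) (A : zgroup_ring) : zgroup_ring :=
  \sum_(h : gT) zgr_elt (expgz h t) *~ A h.

Definition inverse_closed (D : {set gT}) : Prop :=
  zgr_power (-1) (zgr_set D) = zgr_set D.

End GroupRing.

(* Main.v *)
(** Write [a], [b] for [T0], [T1], so that [a b = H - e].  As [|H|] is odd, the
    inverse-closed set [T0] containing [e] has odd size, hence [|T0| = n + 1] and
    [|T1| = n].  Write [a^2 = a^(2) + 2 u] with [u >= 0], and put
    [Y = (n/2) H - u b].  From [a^2 b = (n + 1) H - a] one gets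
    [2 Y = a^(2) b + a - H], so the integral element [Y] has coefficients [>= -1/2],
    i.e. [>= 0]; moreover [a Y = u].  If [y <> e] lies in [T0], the second equation
    bounds the coefficient of [y^2] in [a^2 = a^(2) + 2 u] by 1, so [u] vanishes at
    [y^2] and [Y] at [y].  The coefficient [n/2] of [e] in [u = a Y] is thus that of
    [e] in [Y], whence [u >= n/2] on [T0].  But [2 u <= a^2 <= 2] off [e], so
    [n <= 2]. *)
Require Import Defs.
From mathcomp Require Import all_boot all_order all_algebra all_fingroup.
From mathcomp Require Import cyclic zify.

Import Order.TTheory GRing.Theory Num.Theory.
Local Open Scope ring_scope.

Section GroupRingTheory.

Variable gT : finGroupType.
Implicit Types (A B : zgroup_ring gT) (D : {set gT}) (g h : gT).

Lemma zgr_addE A B h : (A + B) h = A h + B h.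
Proof. by rewrite ffunE. Qed.

Lemma zgr_oppE A h : (- A) h = - A h.
Proof. by rewrite ffunE. Qed.

Lemma zgr_mulrnE A m h : (A *+ m) h = A h *+ m.
Proof.
by elim: m => [|m IHm]; rewrite ?mulr0n ?ffunE // !mulrS zgr_addE IHm.
Qed.

Lemma zgr_mulE A B h : (A * B) h = \sum_k A k * B (k^-1 * h)%g.
Proof. by rewrite ffunE. Qed.

Lemma zgr_sumE (I : finType) (P : pred I) (F : I -> zgroup_ring gT) h :
  (\sum_(i | P i) F i) h = \sum_(i | P i) F i h.
Proof.
by apply: (big_morph (fun A : zgroup_ring gT => A h)) => [A B|];
  rewrite ?zgr_addE ?ffunE.
Qed.

Lemma zgr_eltE g h : zgr_elt g h = (h == g)%:R.
Proof. by rewrite ffunE. Qed.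

Lemma zgr_setE D h : zgr_set D h = (h \in D)%:R.
Proof.
rewrite zgr_sumE; under eq_bigr => d _ do rewrite zgr_eltE.
case: (boolP (h \in D)) => hD.
  rewrite (bigD1 h) //= eqxx big1 ?addr0 // => d /andP[_ /negPf].
  by rewrite eq_sym => ->.
by rewrite big1 // => d dD; case: eqP => // hd; rewrite hd dD in hD.
Qed.

Lemma zgr_power_set t D :
  zgr_power t (zgr_set D) = \sum_(d in D) zgr_elt (expgz d t).
Proof.
rewrite [RHS]big_mkcond; apply: eq_bigr => h _.
by rewrite zgr_setE; case: (h \in D).
Qed.

Lemma zgr_elt_mul g h : zgr_elt g * zgr_elt h = zgr_elt (g * h)%g.
Proof.
apply/ffunP=> x; rewrite zgr_mulE (bigD1 g) //= big1 ?addr0 => [|k kg].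
  by rewrite !zgr_eltE eqxx mul1r (can2_eq (mulKVg _) (mulKg _)).
by rewrite zgr_eltE (negPf kg) mul0r.
Qed.

(** Were [h^-1] outside [D], its coefficient in [D] would be 0; but [h] contributes 1 to it in
    [D^(-1)], where nothing cancels. *)
Lemma inverse_closedV D h : inverse_closed D -> h \in D -> (h^-1)%g \in D.
Proof.
move=> Dinv hD; have : zgr_set D (h^-1)%g = zgr_set D (h^-1)%g by [].
rewrite -{1}Dinv zgr_power_set zgr_sumE (bigD1 h) //= zgr_eltE eqxx zgr_setE.
case: (_ \in D) => //= /eqP; rewrite gt_eqF // ltr_pwDl //.
by apply: sumr_ge0 => d _; rewrite zgr_eltE.
Qed.

Definition zgr_ge0 A := forall h, 0 <= A h.

Lemma zgr_set_ge0 D : zgr_ge0 (zgr_set D).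
Proof. by move=> h; rewrite zgr_setE. Qed.

Lemma zgr_add_ge0 A B : zgr_ge0 A -> zgr_ge0 B -> zgr_ge0 (A + B).
Proof. by move=> A0 B0 h; rewrite zgr_addE addr_ge0. Qed.

Lemma zgr_mul_ge0 A B : zgr_ge0 A -> zgr_ge0 B -> zgr_ge0 (A * B).
Proof. by move=> A0 B0 h; rewrite zgr_mulE sumr_ge0 // => k _; rewrite mulr_ge0. Qed.

Lemma zgr_power_set_ge0 t D : zgr_ge0 (zgr_power t (zgr_set D)).
Proof.
by move=> h; rewrite zgr_power_set zgr_sumE sumr_ge0 // => d _; rewrite zgr_eltE.
Qed.

Lemma zgr_power_set_ge1 t D h : h \in D ->
  1 <= zgr_power t (zgr_set D) (expgz h t).
Proof.
move=> hD; rewrite zgr_power_set zgr_sumE (bigD1 h) //= zgr_eltE eqxx.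
by rewrite lerDl sumr_ge0 // => d _; rewrite zgr_eltE.
Qed.

(** A single term of a convolution of nonnegative terms. It carries bounds from [Y] over to
    [a * Y = u]. *)
Lemma le_zgr_mul A B g h : zgr_ge0 A -> zgr_ge0 B -> A g * B h <= (A * B) (g * h)%g.
Proof.
move=> A0 B0; rewrite zgr_mulE (bigD1 g) //= mulKg lerDl.
by apply: sumr_ge0 => k _; rewrite mulr_ge0.
Qed.

(** The augmentation homomorphism to the integers, which turns group-ring identities into counts. *)
Definition zgr_aug A : int := \sum_h A h.

Lemma zgr_augD A B : zgr_aug (A + B) = zgr_aug A + zgr_aug B.
Proof. by rewrite -big_split; apply: eq_bigr => h _; rewrite zgr_addE. Qed.

Lemma zgr_augN A : zgr_aug (- A) = - zgr_aug A.
Proof. by rewrite -sumrN; apply: eq_bigr => h _; rewrite zgr_oppE. Qed.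

Lemma zgr_augM A B : zgr_aug (A * B) = zgr_aug A * zgr_aug B.
Proof.
rewrite /zgr_aug; under eq_bigr => h _ do rewrite zgr_mulE.
rewrite exchange_big mulr_suml; apply: eq_bigr => k _.
rewrite mulr_sumr (reindex_inj (mulgI k)) /=.
by apply: eq_bigr => h _; rewrite mulKg.
Qed.

Lemma zgr_aug_elt g : zgr_aug (zgr_elt g) = 1.
Proof.
rewrite /zgr_aug (bigD1 g) //= zgr_eltE eqxx big1 ?addr0 // => h /negPf hg.
by rewrite zgr_eltE hg.
Qed.

Lemma zgr_aug_sum_elt D (f : gT -> gT) :
  zgr_aug (\sum_(d in D) zgr_elt (f d)) = #|D|%:R.
Proof.
rewrite (big_morph zgr_aug zgr_augD (id1 := 0)); last first.
  by rewrite /zgr_aug big1 // => h _; rewrite ffunE.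
by under eq_bigr => d _ do rewrite zgr_aug_elt; rewrite sumr_const.
Qed.

Lemma zgr_aug_set D : zgr_aug (zgr_set D) = #|D|%:R.
Proof. exact: (zgr_aug_sum_elt D id). Qed.

Lemma zgr_mulT A h : (A * zgr_set [set: gT]) h = zgr_aug A.
Proof.
by rewrite zgr_mulE; apply: eq_bigr => k _; rewrite zgr_setE inE mulr1.
Qed.

Lemma zgr_set_sqr1 D : inverse_closed D -> (zgr_set D * zgr_set D) 1%g = #|D|%:R.
Proof.
move=> Dinv; rewrite zgr_mulE -zgr_aug_set; apply: eq_bigr => k _.
rewrite mulg1 !zgr_setE; case: (boolP (k \in D)) => [kD|]; last by rewrite mul0r.
by rewrite inverse_closedV.
Qed.

Hypothesis abgT : abelian [set: gT].

Lemma abelian_mulgC g h : (g * h = h * g)%g.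
Proof. by apply: (centsP abgT); rewrite inE. Qed.

Lemma zgr_mulC A B : A * B = B * A.
Proof.
apply/ffunP=> h; rewrite !zgr_mulE.
have inj : injective (fun k : gT => (k^-1 * h)%g) by move=> x y /mulIg/invg_inj.
rewrite (reindex_inj inj) /=; apply: eq_bigr => k _.
by rewrite mulrC invMg invgK -mulgA [(k * h)%g]abelian_mulgC mulKg.
Qed.

(* Commuting the two factors pairs off all products of distinct elements. *)
Lemma zgr_set_sqr D : exists2 u, zgr_ge0 u &
  zgr_set D * zgr_set D = zgr_power 2 (zgr_set D) + u *+ 2.
Proof.
rewrite zgr_power_set /zgr_set.
(* The induction also carries [A >= 0], since adding [d] enlarges [u] by the cross term [d A]. *)
pose K A (P : zgroup_ring gT) := zgr_ge0 A /\ exists2 u, zgr_ge0 u & A * A = P + u *+ 2.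
suff [] : K (\sum_(d in D) zgr_elt d) (\sum_(d in D) zgr_elt (expgz d 2)) by [].
apply: (big_rec2 K) => [|d A P _ [A0 [u u0 EA]]].
  have z0 : zgr_ge0 0 by move=> h; rewrite ffunE.
  by split=> //; exists 0; rewrite // mul0r mul0rn addr0.
have d0 : zgr_ge0 (zgr_elt d) by move=> h; rewrite zgr_eltE.
split; first exact: zgr_add_ge0.
exists (u + zgr_elt d * A); first exact: zgr_add_ge0 _ _ u0 (zgr_mul_ge0 _ _ d0 A0).
rewrite mulrDl !mulrDr zgr_elt_mul EA (zgr_mulC A) mulrnDl.
by rewrite [(_ * A) *+ 2]mulr2n (AC (2*(1*2)) ((1*4)*(5*(2*3)))).
Qed.

End GroupRingTheory.

(** The order of [g] divides both 2 and the odd number [#|gT|]. *)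
Lemma expgz2_eq1 (gT : finGroupType) (g : gT) :
  odd #|gT| -> expgz g 2 = 1%g -> g = 1%g.
Proof.
move=> oddG /= g2; apply/eqP; rewrite -order_eq1 -dvdn1.
have /eqP <- : coprime 2 #|[set: gT]| by rewrite coprime2n cardsT.
by rewrite dvdn_gcd order_dvdn g2 eqxx /= order_dvdG ?inE.
Qed.

Lemma zgr_power2_set1 (gT : finGroupType) (D : {set gT}) :
  odd #|gT| -> 1%g \in D -> zgr_power 2 (zgr_set D) 1%g = 1.
Proof.
move=> oddG D1; rewrite zgr_power_set zgr_sumE (bigD1 1%g) //= zgr_eltE.
rewrite expg1n eqxx big1 ?addr0 // => d /andP[_ d1]; rewrite zgr_eltE.
by case: eqP => // /esym/(expgz2_eq1 _ _ oddG)/eqP; rewrite (negPf d1).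
Qed.

Theorem theorem3p7 (n : nat) (H : finGroupType) :
  (0 < n)%N -> n = 0 %[mod 6] ->
  abelian [set: H] -> #|H| = (n ^ 2 + n + 1)%N ->
  ~ exists T0 T1 : {set H},
      [/\ inverse_closed T0 /\ inverse_closed T1,
          (1%g : H) \in T0,
          (#|T0| + #|T1| = 2 * n + 1)%N,
          zgr_set T0 * zgr_set T1 = zgr_set [set: H] - zgr_elt (1%g : H)
        & zgr_set T0 ^+ 2 + zgr_set T1 ^+ 2
          = zgr_set [set: H] *+ 2
            - zgr_power 2 (zgr_set T0) - zgr_power 2 (zgr_set T1)
            + zgr_elt (1%g : H) *+ (2 * n)].
Proof.
move=> n_gt0 n6 abH cardH [T0 [T1 [[inv0 _] T0e cardT eqM eqS]]].
have [m m_ge3 Dn] : exists2 m, (3 <= m)%N & n = (2 * m)%N.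
  by exists (n %/ 2)%N; lia.
have oddH : odd #|H| by rewrite cardH; lia.
set a := zgr_set T0 in eqM eqS; set b := zgr_set T1 in eqM eqS.
set G := zgr_set [set: H] in eqM eqS.
have GE h : G h = 1 by rewrite zgr_setE inE.
have a0 : zgr_ge0 _ a by apply: zgr_set_ge0.
have b0 : zgr_ge0 _ b by apply: zgr_set_ge0.
have [u u0 sqr_a] := zgr_set_sqr _ abH T0; rewrite -/a in sqr_a.
set a2 := zgr_power 2 a in eqS sqr_a; set b2 := zgr_power 2 b in eqS.
(* Coefficients of [e] in [a^2 = a2 + 2 u]: inverse-closedness gives the left side, odd order the
   1. *)
have u1 : #|T0|%:R = 1 + u 1%g *+ 2 :> int.
  by rewrite -zgr_set_sqr1 // sqr_a zgr_addE zgr_mulrnE zgr_power2_set1.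
have card0 : #|T0| = n.+1.
  have cardM : (#|T0| * #|T1| = n ^ 2 + n)%N.
    have := congr1 (zgr_aug _) eqM.
    rewrite zgr_augM zgr_augD zgr_augN zgr_aug_elt !zgr_aug_set cardsT cardH.
    by rewrite -natrM natrD addrK => /eqP; rewrite eqr_nat => /eqP.
  move: #|T0| #|T1| u1 cardT cardM => p q u1 pq_sum pq_prod.
  (* The sizes have sum [2n + 1] and product [n(n + 1)], so they are [n] and [n + 1]; as [n] is even
     and [p] odd by [u1], [p = n + 1]. *)
  have : (p%:Z - n%:Z) * (p%:Z - n%:Z - 1) == 0.
    have q_eq : q%:Z = 2 * n%:Z + 1 - p%:Z by clear -pq_sum; lia.
    have := congr1 Posz pq_prod.
    rewrite PoszM q_eq; clear; nia.
  rewrite mulf_eq0 => /orP[]; lia.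
have ue : u 1%g = m%:R by move: u1; rewrite card0; lia.
(* The second equation away from [e], with the nonnegative [b^2] and [b2] dropped. *)
have sqr_le (h : H) : h != 1%g -> (a * a) h <= 2 - a2 h.
  move=> /negPf h1; have /ffunP/(_ h) := eqS.
  rewrite !expr2 !(zgr_addE, zgr_oppE, zgr_mulrnE) zgr_eltE h1 GE mul0rn.
  have := zgr_mul_ge0 _ _ _ b0 b0 h; have := zgr_power_set_ge0 _ 2 T1 h.
  rewrite -/b -/b2; lia.
have aG h : (a * G) h = n.+1%:R by rewrite zgr_mulT zgr_aug_set card0.
pose Y : zgroup_ring H := G *+ m - u * b.
have Y0 : zgr_ge0 _ Y.
  move=> h; have : (a * (a * b)) h = (a2 * b) h + (u * b) h *+ 2.
    by rewrite mulrA sqr_a mulrDl mulrnAl zgr_addE zgr_mulrnE.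
  rewrite eqM mulrBr mulr1 !(zgr_addE, zgr_oppE, zgr_mulrnE) aG GE.
  have := zgr_mul_ge0 _ _ _ (zgr_power_set_ge0 _ 2 T0) b0 h; rewrite -/a -/a2.
  have := a0 h; lia.
(* Expanding gives [u + (m(n + 1) - aug u) G]. The bracket vanishes: augmenting [a^2 = a2 + 2 u]
   gives [(n + 1)^2 = (n + 1) + 2 aug u]. *)
have aY : a * Y = u.
  rewrite mulrBr mulrA (zgr_mulC _ abH a u) -mulrA eqM mulrBr mulr1 opprB mulrnAr.
  apply/ffunP=> h; rewrite !(zgr_addE, zgr_oppE, zgr_mulrnE) aG zgr_mulT.
  have := congr1 (zgr_aug _) sqr_a.
  rewrite zgr_augM zgr_augD mulr2n zgr_augD zgr_aug_set.
  rewrite /a2 zgr_power_set zgr_aug_sum_elt card0 -natrM -mulrnA.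
  have -> : (n.+1 * n.+1 = n.+1 + 2 * (n.+1 * m))%N by rewrite Dn; lia.
  rewrite natrD => /addrI; rewrite natrM mulr_natl mulr2n => aug_u.
  have -> : zgr_aug _ u = (n.+1 * m)%:R by lia.
  by rewrite addrC subrK.
have Y_T0 (y : H) : y \in T0 -> y != 1%g -> Y y = 0.
  move=> yT0 y1; have y2 : expgz y 2 != 1%g by apply: contra y1 => /eqP/expgz2_eq1->.
  have := sqr_le _ y2; rewrite sqr_a zgr_addE zgr_mulrnE.
  (* At [y^2] one has [2 a2 + 2 u <= 2] and [a2 >= 1], because [y] itself contributes; so [u <= 0]
     there, while [Y y <= u (y^2)]. *)
  have := zgr_power_set_ge1 _ 2 _ _ yT0; rewrite -/a -/a2.
  have := le_zgr_mul _ _ _ y y a0 Y0; rewrite aY zgr_setE yT0 mul1r.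
  have := Y0 y; rewrite [expgz y 2]/= expgS expg1.
  move: (Y y) (u (y * y)%g) (a2 (y * y)%g) => p q r *; apply: le_anti; lia.
have Y1 : Y 1%g = m%:R.
  rewrite -ue -aY zgr_mulE (bigD1 1%g) //= zgr_setE T0e mul1r invg1 mul1g.
  (* The other terms are [a k * Y (k^-1)]; for [k] in [T0], so is [k^-1], and [Y] vanishes there. *)
  rewrite big1 ?addr0 // => k k1; rewrite mulg1 zgr_setE.
  case: (boolP (k \in T0)) => [kT0|]; last by rewrite mul0r.
  by rewrite Y_T0 ?mulr0 ?inverse_closedV // invg_eq1.
have [x /setD1P[x1 xT0]] : exists x, x \in T0 :\ 1%g.
  apply/set0Pn; rewrite -card_gt0; have := cardsD1 1%g T0.
  by rewrite card0 T0e add1n => -[<-].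
(* Now [m = Y e <= u x <= 1], against [m >= 3]. *)
have := sqr_le _ x1; rewrite sqr_a zgr_addE zgr_mulrnE.
have := zgr_power_set_ge0 _ 2 T0 x; rewrite -/a -/a2.
have := le_zgr_mul _ _ _ x 1%g a0 Y0.
rewrite aY zgr_setE xT0 mul1r mulg1 Y1; move: (u x) (a2 x) => p q; lia.
Qed.
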